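(* Let $T^q$ denote the $q$-torus ($q\ge1$), let $n\ge 1$, and let $f\colon T^q\to D_n(T^q)$ be an $n$-valued map with basic lifting $\bar f^*$. Then $\psi_f(\pi_1(T^q))\subseteq J_n(\bar f^* )$.
   Context: Put $X=T^q=\mathbb R^q/\mathbb Z^q$, with universal covering $p\colon\tilde X=\mathbb R^q\to T^q$, and $\pi_1(X)=\mathbb Z^q$ acting on $\mathbb R^q$ by translations. $D_n(X)$ is the set of $n$-element subsets of $X$, topologized as the quotient by the symmetric group $\Sigma_n$ of $F_n(X)=\{(x_1,\dots,x_n)\in X^n\mid x_i\ne x_j\text{ for }i\neq j\}$. An $n$-valued map is a continuous map $f\colon X\to D_n(X)$. Let $F_n(\tilde X,\pi)=\{(\tilde x_1,\dots,\tilde x_n)\in\tilde X^n\mid \tilde x_i\ne\alpha\tilde x_j \text{ for all } i\neq j,\ \alpha\in\pi_1(X)\}$ and $p^n(\tilde x_1,\dots,\tilde x_n)=\{p(\tilde x_1),\dots,p(\tilde x_n)\}\in D_n(X)$. A lifting of $f$ is a continuous map $\bar f\colon\tilde X\to F_n(\tilde X,\pi)$ with $p^n\circ\bar f=f\circ p$. The group $\pi_1(X)^n\rtimes\Sigma_n$, with product $(\alpha_1,\dots,\alpha_n;\sigma)(\beta_1,\dots,\beta_n;\rho)=(\alpha_1\beta_{\sigma^{-1}(1)},\dots,\alpha_n\beta_{\sigma^{-1}(n)};\sigma\circ\rho)$, acts on $F_n(\tilde X,\pi)$ by $(\alpha_1,\dots,\alpha_n;\sigma)\cdot(\tilde x_1,\dots,\tilde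 x_n)=(\alpha_1\tilde x_{\sigma^{-1}(1)},\dots,\alpha_n\tilde x_{\sigma^{-1}(n)})$. Choose $\tilde x^*\in\tilde X$ and $\tilde x^{(0)}\in F_n(\tilde X,\pi)$ with $p^n(\tilde x^{(0)})=f(p(\tilde x^* ))$; the basic lifting $\bar f^*$ is the unique lifting of $f$ with $\bar f^*(\tilde x^* )=\tilde x^{(0)}$. Every lifting of $f$ is uniquely of the form $\Gamma\bar f^*$ with $\Gamma\in\pi_1(X)^n\rtimes\Sigma_n$. The homomorphism $\psi_f\colon\pi_1(X)\to\pi_1(X)^n\rtimes\Sigma_n$ is defined by $\psi_f(\gamma)\circ\bar f^*=\bar f^*\circ\gamma$. A cyclic homotopy of $f$ is a homotopy $H\colon X\times[0,1]\to D_n(X)$ with $H(x,0)=H(x,1)=f(x)$ for all $x$. It lifts to a homotopy $\tilde X\times[0,1]\to F_n(\tilde X,\pi)$ starting at $\bar f^*$ and ending at $\Gamma\bar f^*$ for a unique $\Gamma\in\pi_1(X)^n\rtimes\Sigma_n$. The Jiang subgroup $J_n(\bar f^* )$ is the set of all elements $\Gamma$ so obtained from cyclic homotopies of $f$. *)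

(* Defs.v *)
From HB Require Import structures.
From mathcomp Require Import all_boot all_order all_fingroup all_algebra.
From mathcomp Require Import generic_quotient zify lra.
From mathcomp Require Import all_classical all_reals topology normedtype.

Set Implicit Arguments.
Unset Strict Implicit.
Unset Printing Implicit Defensive.

Import Order.TTheory GRing.Theory Num.Theory.
Import numFieldNormedType.Exports.

Local Open Scope classical_set_scope.
Local Open Scope ring_scope.
Local Open Scope card_scope.
Local Open Scope quotient_scope.

(* F_n(X), as a subspace of X^n with the product topology *)
Definition conf_set (X : topologicalType) (n : nat) : set {ptws 'I_n -> X} :=
  [set x | injective x].
Arguments conf_set : clear implicits.

Definition conf (X : topologicalType) (n : nat) := set_type (conf_set X n).
HB.instance Definition _ (X : topologicalType) (n : nat) :=
  Topological.on (conf X n).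

(* The set of n-element subsets of X. The map (x_1, ..., x_n) |->
   {x_1, ..., x_n} presents it as a quotient of F_n(X): its fibres are the
   orbits of the permutation of coordinates. *)
Definition nsubset (X : Type) (n : nat) :=
  set_type [set A : set X | A #= `I_n].

Section nsubset_quotient.
Variables (X : topologicalType) (n : nat).

Lemma card_range_conf (x : conf X n) :
  range (val x : 'I_n -> X) \in [set A : set X | A #= `I_n].
Proof.
have xi : injective (val x) := set_mem (valP x).
rewrite inE/=; apply: (@card_eq_trans _ _ _ _ [set: 'I_n]).
  by apply: inj_card_eq => i j _ _; exact: xi.
exact/card_esym/card_II.
Qed.

Definition nsubset_pi (x : conf X n) : nsubset X n :=
  SigSub (card_range_conf x).

Lemma nsubset_pi_surj (A : nsubset X n) : exists x, nsubset_pi x = A.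
Proof.
case: A => A Acard; have /= := set_mem Acard.
move=> /card_eq_trans/(_ (@card_II n))/card_bijP[f [g fK gK]].
pose x : {ptws 'I_n -> X} := fun i => val (g (to_setT i)).
have xi : x \in conf_set X n.
  rewrite inE => i j /val_inj/(can_inj gK) ij.
  by have := congr1 val ij.
exists (SigSub xi); apply: val_inj => /=; apply/seteqP; split.
  by move=> _ [i _ <-]; exact: set_mem (valP (g _)).
move=> y Ay; pose y' : A := SigSub (mem_set Ay).
exists (val (f y')) => //; rewrite /x.
by have -> : to_setT (val (f y')) = f y' by [exact: val_inj]; rewrite fK.
Qed.

Definition nsubset_repr (A : nsubset X n) : conf X n :=
  projT1 (cid (nsubset_pi_surj A)).

Lemma nsubset_reprK : cancel nsubset_repr nsubset_pi.
Proof. by move=> A; rewrite /nsubset_repr; case: cid. Qed.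

HB.instance Definition _ :=
  isQuotient.Build (conf X n) (nsubset X n) nsubset_reprK.

End nsubset_quotient.

Definition Dn (X : topologicalType) (n : nat) :=
  quotient_topology (nsubset X n).
HB.instance Definition _ (X : topologicalType) (n : nat) :=
  Topological.on (Dn X n).
HB.instance Definition _ (X : topologicalType) (n : nat) :=
  Quotient.on (Dn X n).

Section torus.
Variables (R : realType) (q : nat).

Definition deck (a : 'rV[int]_q) (x : 'rV[R]_q) : 'rV[R]_q :=
  map_mx intr a + x.

Definition torus_rel : rel 'rV[R]_q :=
  fun x y => `[< exists a, y = deck a x >].

Lemma torus_rel_refl : reflexive torus_rel.
Proof.
by move=> x; apply/asboolP; exists 0; rewrite /deck map_mx0 add0r.
Qed.

Lemma torus_rel_sym : symmetric torus_rel.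
Proof.
have H x y : torus_rel x y -> torus_rel y x.
  move=> /asboolP[a ->]; apply/asboolP; exists (- a).
  by rewrite /deck map_mxN addKr.
by move=> x y; apply/idP/idP; exact: H.
Qed.

Lemma torus_rel_trans : transitive torus_rel.
Proof.
move=> y x z /asboolP[a ->] /asboolP[b ->]; apply/asboolP; exists (b + a).
by rewrite /deck map_mxD addrA.
Qed.

Canonical torus_equiv :=
  EquivRel torus_rel torus_rel_refl torus_rel_sym torus_rel_trans.

Definition torus := quotient_topology {eq_quot torus_rel}.
HB.instance Definition _ := Topological.on torus.
HB.instance Definition _ := Quotient.on torus.

Definition torus_pi : 'rV[R]_q -> torus := \pi_torus.

Lemma torus_piP x y : torus_pi x = torus_pi y <-> exists a, y = deck a x.
Proof.
rewrite /torus_pi; split=> [/(@eqquotP _ torus_equiv)/asboolP|]// xy.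
by apply/(@eqquotP _ torus_equiv)/asboolP.
Qed.

End torus.

(* The group pi_1(T^q)^n ><| Sigma_n. Products of permutations are read from
   left to right in the library, so that sigma \o rho is [rho * sigma]. *)
Definition wreath (q n : nat) := ({ffun 'I_n -> 'rV[int]_q} * 'S_n)%type.

Section wreath_group.
Variables q n : nat.
Implicit Types g h k : wreath q n.

HB.instance Definition _ := Choice.on (wreath q n).

Definition wreath_one : wreath q n := ([ffun=> 0], 1%g).
Definition wreath_mul g h : wreath q n :=
  ([ffun i => g.1 i + h.1 (g.2^-1%g i)], (h.2 * g.2)%g).
Definition wreath_inv g : wreath q n := ([ffun i => - g.1 (g.2 i)], g.2^-1%g).

Lemma wreath_mulA : associative wreath_mul.
Proof.
move=> g h k; congr (_, _); last by rewrite /= mulgA.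
by apply/ffunP => i; rewrite !ffunE/= invMg permM addrA.
Qed.

Lemma wreath_mul1 : left_id wreath_one wreath_mul.
Proof.
move=> [a s]; congr (_, _); last by rewrite /= mulg1.
by apply/ffunP => i; rewrite !ffunE/= invg1 perm1 add0r.
Qed.

Lemma wreath_1mul : right_id wreath_one wreath_mul.
Proof.
move=> [a s]; congr (_, _); last by rewrite /= mul1g.
by apply/ffunP => i; rewrite !ffunE/= addr0.
Qed.

Lemma wreath_mulV : left_inverse wreath_one wreath_inv wreath_mul.
Proof.
move=> [a s]; congr (_, _); last by rewrite /= mulgV.
by apply/ffunP => i; rewrite !ffunE/= invgK addNr.
Qed.

Lemma wreath_Vmul : right_inverse wreath_one wreath_inv wreath_mul.
Proof.
move=> [a s]; congr (_, _); last by rewrite /= mulVg.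
by apply/ffunP => i; rewrite !ffunE/= permKV addrN.
Qed.

HB.instance Definition _ := isGroup.Build (wreath q n)
  wreath_mulA wreath_mul1 wreath_1mul wreath_mulV wreath_Vmul.
HB.instance Definition _ := isPointed.Build (wreath q n) 1%g.

End wreath_group.

Section liftings.
Variables (R : realType) (q n : nat).
Local Notation V := 'rV[R]_q.
Local Notation T := (torus R q).
Local Notation G := (wreath q n).

(* F_n(R^q, pi) *)
Definition uconf_set : set {ptws 'I_n -> V} :=
  [set x | forall i j, i != j -> forall a, x i <> deck a (x j)].
Definition uconf := set_type uconf_set.
HB.instance Definition _ := Topological.on uconf.

Lemma conf_of_uconf_subproof (x : uconf) :
  (fun i => torus_pi (val x i)) \in conf_set T n.
Proof.
rewrite inE => i j /esym/torus_piP[a xij]; apply: contraPP xij => /eqP ij.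
exact: (set_mem (valP x)).
Qed.

Definition conf_of_uconf (x : uconf) : conf T n :=
  SigSub (conf_of_uconf_subproof x).

Definition pn (x : uconf) : Dn T n := \pi_(Dn T n) (conf_of_uconf x).

Lemma wreath_act_subproof (g : G) (x : uconf) :
  (fun i => deck (g.1 i) (val x (g.2^-1%g i))) \in uconf_set.
Proof.
rewrite inE => i j ij a; rewrite /deck => e.
have /= := set_mem (valP x) (g.2^-1%g i) (g.2^-1%g j).
rewrite (inj_eq perm_inj) => /(_ ij (- g.1 i + (a + g.1 j))); apply.
by rewrite /deck !map_mxD map_mxN -!addrA -e addKr.
Qed.

Definition wreath_act (g : G) (x : uconf) : uconf :=
  SigSub (wreath_act_subproof g x).

Local Notation U := uconf.

Lemma deckD a b (x : V) : deck (a + b) x = deck a (deck b x).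
Proof. by rewrite /deck map_mxD addrA. Qed.

Lemma deck0 (x : V) : deck 0 x = x.
Proof. by rewrite /deck map_mx0 add0r. Qed.

Lemma deck_inj a b (x : V) : deck a x = deck b x -> a = b.
Proof.
move/addIr/matrixP => ab; apply/matrixP => i j; have := ab i j.
by rewrite !mxE => /intr_inj.
Qed.

Lemma uconfP (x y : U) : (forall i, val x i = val y i) -> x = y.
Proof. by move=> xy; apply: val_inj; apply/funext. Qed.

Lemma uconf_inj (x : U) i j a : val x i = deck a (val x j) -> i = j.
Proof. by apply: contraPP => /eqP ij; exact: (set_mem (valP x)). Qed.

Lemma wreath_act1 (x : U) : wreath_act 1%g x = x.
Proof. by apply: uconfP => i /=; rewrite ffunE deck0 invg1 perm1. Qed.

Lemma wreath_actM g h (x : U) :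
  wreath_act (g * h)%g x = wreath_act g (wreath_act h x).
Proof. by apply: uconfP => i /=; rewrite ffunE deckD invMg permM. Qed.

Lemma wreath_act_free g h (x : U) : wreath_act g x = wreath_act h x -> g = h.
Proof.
move=> gh; have e i : deck (g.1 i) (val x (g.2^-1%g i)) =
    deck (h.1 i) (val x (h.2^-1%g i)) by have /(congr1 (fun y => val y i)) := gh.
have s i : g.2^-1%g i = h.2^-1%g i.
  apply: (@uconf_inj x _ _ (- g.1 i + h.1 i)).
  by rewrite deckD -e -deckD addNr deck0.
have gh2 : g.2 = h.2 by apply: invg_inj; apply/permP.
case: g h {gh} e s gh2 => [a s] [b t] /= e _ st; rewrite st in e *.
by congr (_, _); apply/ffunP => i; exact: deck_inj (e i).
Qed.

Lemma val_pn (x : U) :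
  (val (pn x : nsubset T n) : set T) = range (fun i => torus_pi (val x i)).
Proof. by rewrite /pn !unlock. Qed.

Lemma pn_eqP (x y : U) : pn x = pn y <-> exists g, wreath_act g x = y.
Proof.
split=> [xy|[g <-]]; last first.
  apply: (@val_inj _ _ (nsubset T n)); rewrite !val_pn; apply/seteqP.
  split => [_ [i _ <-]|_ [i _ <-]].
    exists (g.2 i) => //=; rewrite permK; apply/esym/torus_piP.
    by exists (g.1 (g.2 i)).
  exists (g.2^-1%g i) => //=; apply/torus_piP.
  by exists (g.1 i).
have H i : exists j, exists a, val y i = deck a (val x j).
  have : range (fun i => torus_pi (val y i)) (torus_pi (val y i)) by exists i.
  by rewrite -val_pn -xy val_pn => -[j _ /torus_piP[a ?]]; exists j, a.
pose s i := projT1 (cid (H i)).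
have /= sP i : exists a, val y i = deck a (val x (s i)) by rewrite /s; case: cid.
have sI : injective s.
  move=> i j ij; have [[a ya] [b yb]] := (sP i, sP j).
  apply: (@uconf_inj y _ _ (a - b)).
  by rewrite [LHS]ya [val y j]yb ij -deckD subrK.
exists ([ffun i => projT1 (cid (sP i))], (perm sI)^-1%g).
by apply: uconfP => i; rewrite /= ffunE invgK permE; case: cid.
Qed.

Definition is_lifting (f : T -> Dn T n) (fbar : V -> uconf) :=
  continuous fbar /\ forall x, pn (fbar x) = f (torus_pi x).

Definition is_basic_lifting (f : T -> Dn T n) (xs : V) (x0 : uconf)
    (fbar : V -> uconf) :=
  [/\ pn x0 = f (torus_pi xs), is_lifting f fbar & fbar xs = x0].

Lemma near_int (r : R) :
  exists2 e : R, 0 < e & forall m : int, `|r - m%:~R| < e -> r = m%:~R.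
Proof.
set k := Num.floor r; have /andP[kr rk] := floor_itv r.
have [rZ|rZ] := eqVneq r k%:~R.
  exists 1 => // m; rewrite ltr_norml {2}rZ => /andP[].
  have [mk|km|->//] := ltgtP m k.
    by have : m%:~R <= (k - 1)%:~R :> R by [rewrite ler_int; lia];
      rewrite intrB; lra.
  by have : (k + 1)%:~R <= m%:~R :> R by [rewrite ler_int; lia];
    rewrite intrD; lra.
have {rZ kr} kr : k%:~R < r by rewrite lt_neqAle eq_sym rZ.
exists (Num.min (r - k%:~R) ((k + 1)%:~R - r)).
  by rewrite lt_min !subr_gt0 kr.
move=> m; rewrite lt_min !ltr_norml => /andP[/andP[_ h1] /andP[h2 _]].
have [mk|km] := leP m k.
  by have : m%:~R <= k%:~R :> R by [rewrite ler_int]; lra.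
by have : (k + 1)%:~R <= m%:~R :> R by [rewrite ler_int; lia]; lra.
Qed.

Lemma uconf_coord_continuous (f : V -> U) i k : continuous f ->
  continuous (fun x => val (f x) i 0 k).
Proof.
move=> cf x; apply: (@continuous_comp _ _ _ (fun x => val (f x) i)
  (fun v : V => v 0 k)); last exact: coord_continuous.
apply: (@continuous_comp _ _ _ (fun x => val (f x))
  (fun w : {ptws 'I_n -> V} => w i)); last exact: proj_continuous.
by apply: (@continuous_comp _ _ _ f); [exact: cf|exact: initial_continuous].
Qed.

Lemma uconf_near (f1 f2 : V -> U) (x0 : V) :
  (forall i k, continuous (fun x => val (f1 x) i 0 k)) ->
  (forall i k, continuous (fun x => val (f2 x) i 0 k)) ->
  f1 x0 = f2 x0 -> (forall x, pn (f1 x) = pn (f2 x)) ->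
  \forall x \near x0, f1 x = f2 x.
Proof.
move=> cf1 cf2 f12 pf12.
have near_ij i j : \forall x \near x0, forall b,
    val (f1 x) i = deck b (val (f2 x) j) -> i = j /\ b = 0.
  pose r k := val (f1 x0) i 0 k - val (f2 x0) j 0 k.
  have : \forall x \near x0, forall k, forall b : 'rV[int]_q,
      val (f1 x) i = deck b (val (f2 x) j) -> r k = (b 0 k)%:~R.
    apply: (@filter_forall _ _ _ (nbhs x0)) => k.
    have [e e0 re] := near_int (r k).
    have : {for x0, continuous
        (fun x : V => val (f1 x) i 0 k - val (f2 x) j 0 k)}.
      by apply: continuousB; [exact: cf1|exact: cf2].
    move=> /cvgr_dist_lt/(_ e e0); apply: filterS => x xe b xb.
    apply: re; move: xe; rewrite xb !mxE addrK.
    exact.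
  apply: filterS => x xr b xb.
  have yb : val (f1 x0) i = deck b (val (f2 x0) j).
    by apply/rowP => k; rewrite !mxE -(xr k b xb) subrK.
  have ij : i = j by apply: (@uconf_inj (f1 x0) _ _ b); rewrite yb f12.
  split=> //; apply: (@deck_inj _ _ (val (f1 x0) i)).
  by rewrite deck0 {2}yb ij f12.
have : \forall x \near x0, forall i j b,
    val (f1 x) i = deck b (val (f2 x) j) -> i = j /\ b = 0.
  apply: (@filter_forall _ _ _ (nbhs x0)) => i.
  by apply: (@filter_forall _ _ _ (nbhs x0)) => j; exact: near_ij.
apply: filterS => x H; apply: uconfP => i.
have [g gx] : exists g, wreath_act g (f2 x) = f1 x by apply/pn_eqP.
have e : val (f1 x) i = deck (g.1 i) (val (f2 x) (g.2^-1%g i)) by rewrite -gx.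
by have [ij b0] := H _ _ _ e; rewrite e b0 -ij deck0.
Qed.

Lemma deck_continuous a : continuous (@deck R q a).
Proof. by move=> x; apply: continuousD => //; exact: cst_continuous. Qed.

Lemma lifting_near (f : T -> Dn T n) fbar g a (x0 : V) :
  is_lifting f fbar -> wreath_act g (fbar x0) = fbar (deck a x0) ->
  \forall x \near x0, wreath_act g (fbar x) = fbar (deck a x).
Proof.
move=> [cf fE] gx0; apply: uconf_near => // [i k|i k|x].
- move=> x; rewrite /=.
  under eq_fun do rewrite mxE.
  by apply: continuousD;
    [exact: cst_continuous|exact: uconf_coord_continuous].
- move=> x; apply: (@continuous_comp _ _ _ (deck a)
    (fun x => val (fbar x) i 0 k)); first exact: deck_continuous.
  exact: uconf_coord_continuous.
- transitivity (pn (fbar x)); first by apply/esym/pn_eqP; exists g.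
  by rewrite !fE; congr f; apply/torus_piP; exists a.
Qed.

Lemma psi_exists (f : T -> Dn T n) fbar a : is_lifting f fbar ->
  exists g : G, wreath_act g \o fbar = fbar \o deck a.
Proof.
move=> flift; have [_ fE] := flift.
have ex x : exists g, wreath_act g (fbar x) = fbar (deck a x).
  apply/pn_eqP; rewrite !fE; congr f; apply/torus_piP; by exists a.
have [g g0] := ex 0; exists g; apply/funext => v /=.
pose A : set R := [set t | wreath_act g (fbar (t *: v)) = fbar (deck a (t *: v))].
have scv : continuous (fun t : R => t *: v) by exact: scalel_continuous.
have oA : open A.
  rewrite openE => t At; exact: (scv t _ (lifting_near flift At)).
have cA : closed A.
  rewrite -[A]setCK; apply: open_closedC; rewrite openE => t At.
  have [h ht] := ex (t *: v).
  apply: (@filterS _ (nbhs t) _ _ _ _ (scv t _ (lifting_near flift ht))).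
  move=> s /= hs As; apply: At; rewrite /A /=; suff -> : g = h by [].
  by apply: (@wreath_act_free _ _ (fbar (s *: v))); rewrite hs.
have AT : A = setT.
  have : connected [set: R] by apply/connected_intervalP.
  apply; first by exists 0; rewrite /A /= scale0r.
    by exists A => //; rewrite setTI.
  by exists A => //; rewrite setTI.
by have : A 1 by [rewrite AT]; rewrite /A /= scale1r.
Qed.

(* The element g such that g \o fbar = fbar \o a; psi_exists and psi_unique
   show that it exists and is unique whenever fbar is a lifting. *)
Definition psi (fbar : V -> uconf) (a : 'rV[int]_q) : G :=
  get [set g | wreath_act g \o fbar = fbar \o deck a].

Lemma psiP (f : T -> Dn T n) fbar a : is_lifting f fbar ->
  wreath_act (psi fbar a) \o fbar = fbar \o deck a.
Proof. by move=> /psi_exists-/(_ a) h; exact: (getPex h). Qed.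

Lemma psi_unique (f : T -> Dn T n) fbar a g : is_lifting f fbar ->
  wreath_act g \o fbar = fbar \o deck a -> g = psi fbar a.
Proof.
move=> flift ga; apply: (@wreath_act_free _ _ (fbar 0)).
by have /(congr1 (@^~ 0))/= := etrans ga (esym (psiP a flift)).
Qed.

Lemma psiD (f : T -> Dn T n) fbar a b : is_lifting f fbar ->
  psi fbar (a + b) = (psi fbar a * psi fbar b)%g.
Proof.
move=> flift; apply/esym/(psi_unique flift)/funext => x /=.
have psiE c y : wreath_act (psi fbar c) (fbar y) = fbar (deck c y).
  by have /(congr1 (@^~ y)) := psiP c flift.
by rewrite wreath_actM !psiE deckD.
Qed.

Local Notation I01 := (set_type (`[0, 1]%classic : set R)).

Lemma I0_subproof : (0 : R) \in (`[0, 1]%classic : set R).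
Proof. by rewrite mem_setE bound_itvE. Qed.

Lemma I1_subproof : (1 : R) \in (`[0, 1]%classic : set R).
Proof. by rewrite mem_setE bound_itvE. Qed.

Definition I0 : I01 := SigSub I0_subproof.
Definition I1 : I01 := SigSub I1_subproof.

Definition cyclic_homotopy (f : T -> Dn T n) (H : T * I01 -> Dn T n) :=
  [/\ continuous H, forall x, H (x, I0) = f x & forall x, H (x, I1) = f x].

Definition Jiang (f : T -> Dn T n) (fbar : V -> uconf) : set G :=
  [set g | exists H Hbar,
    [/\ cyclic_homotopy f H,
        continuous (Hbar : V * I01 -> uconf) /\
          (forall x t, pn (Hbar (x, t)) = H (torus_pi x, t)),
        forall x, Hbar (x, I0) = fbar x &
        forall x, Hbar (x, I1) = wreath_act g (fbar x)]].

End liftings.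

(* Main.v *)
Require Import Defs.
From HB Require Import structures.
From mathcomp Require Import all_boot all_order all_fingroup all_algebra.
From mathcomp Require Import all_classical all_reals topology normedtype.
From mathcomp Require Import generic_quotient.
Import Order.TTheory GRing.Theory Num.Theory.
Import numFieldNormedType.Exports.
Local Open Scope classical_set_scope.
Local Open Scope ring_scope.

(** The torus is a group acting on itself, and translation by [t a], for [t]
    from [0] to [1], is a loop of self-maps of [T^q] based at the identity
    because the integral vector [a] is zero in the torus. Precomposing [f]
    with it gives the cyclic homotopy [H (y, t) = f (y + t a)]. It is covered
    by [Hbar (x, t) = fbar (x + t a)], which starts at [fbar] and ends at
    [fbar \o deck a], that is, at [psi fbar a] acting on [fbar].

    The point that needs an argument is the continuity of [H] on the product
    of the torus, a quotient space, with the interval, since a product of a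
    quotient map with an identity need not be a quotient map. It is one here
    because the covering projection is open ([torus_pi_nbhs]); this makes
    [(y, t) |-> y + t a] continuous ([torus_flow_continuous]). *)

Section torus_flow.
Set Implicit Arguments.
Unset Strict Implicit.
Variables (R : realType) (q : nat).
Local Notation V := 'rV[R]_q.
Local Notation T := (torus R q).
Local Notation I01 := (set_type (`[0, 1]%classic : set R)).

Lemma torus_pi_continuous : continuous (@torus_pi R q).
Proof. exact: pi_continuous. Qed.

Lemma torus_pi_deck a (x : V) : torus_pi (deck a x) = torus_pi x.
Proof. by apply/esym/torus_piP; exists a. Qed.

Lemma torus_pi_repr (y : T) : torus_pi (repr y) = y.
Proof. exact: reprK. Qed.

(** The saturation of an open set [A] is the union of the translates of [A]
    by deck transformations, which are homeomorphisms. *)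
Lemma torus_pi_open (A : set V) : open A -> open (@torus_pi R q @` A).
Proof.
move=> oA.
have -> : open (@torus_pi R q @` A) =
    open (@torus_pi R q @^-1` (@torus_pi R q @` A)) by [].
rewrite (_ : _ @^-1` _ = \bigcup_(a : 'rV[int]_q) @deck R q a @^-1` A).
  apply: bigcup_open => a _; apply: open_comp => // x _.
  exact: deck_continuous.
apply/seteqP; split=> [x /= [y Ay /esym/torus_piP[a yE]]|x [a _ Ax]].
  by exists a => //=; rewrite -yE.
by exists (deck a x) => //; exact: torus_pi_deck.
Qed.

Lemma torus_pi_nbhs (x : V) (A : set V) :
  nbhs x A -> nbhs (torus_pi x) (@torus_pi R q @` A).
Proof.
rewrite nbhsE => -[B [oB Bx] BA].
apply: (@filterS _ _ _ (@torus_pi R q @` B)); first exact: image_subset.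
by apply: open_nbhs_nbhs; split; [exact: torus_pi_open|exists x].
Qed.

(** The straight-line isotopy from the identity to the deck transformation
    [a]. *)
Definition flow (a : 'rV[int]_q) (z : V * I01) : V :=
  z.1 + val z.2 *: map_mx intr a.

(** The isotopy that [flow a] induces on the torus. It commutes with deck
    transformations, so the chosen representative does not matter
    ([torus_flowE]). *)
Definition torus_flow (a : 'rV[int]_q) (z : T * I01) : T :=
  torus_pi (flow a (repr z.1, z.2)).

Lemma flow0 a x : flow a (x, I0 R) = x.
Proof. by rewrite /flow/= scale0r addr0. Qed.

Lemma flow1 a x : flow a (x, I1 R) = deck a x.
Proof. by rewrite /flow/= scale1r addrC. Qed.

Lemma flow_continuous a : continuous (flow a).
Proof.
move=> z; apply: continuousD; first exact: cvg_fst.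
apply: (@continuous_comp _ _ _ (fun z : V * I01 => val z.2)
  (fun t : R => t *: map_mx intr a)); last exact: scalel_continuous.
apply: (@continuous_comp _ _ _ (@snd V I01) (fun s : I01 => val s));
  first exact: cvg_snd.
exact: initial_continuous.
Qed.

Lemma torus_flowE a x t :
  torus_flow a (torus_pi x, t) = torus_pi (flow a (x, t)).
Proof.
have /torus_piP[b xE] := torus_pi_repr (torus_pi x).
apply/torus_piP; exists b.
by rewrite /flow/deck/= addrA; congr (_ + _).
Qed.

(** A neighbourhood [A] of a point of the fibre over [y], given by the
    continuity of the flow upstairs, projects to a neighbourhood of [y]. *)
Lemma torus_flow_continuous a : continuous (torus_flow a).
Proof.
move=> [y t] W; rewrite -(torus_pi_repr y) torus_flowE => nW.
have /= := @continuous_comp _ _ _ (flow a) (@torus_pi R q) (repr y, t)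
  (@flow_continuous a _) (@torus_pi_continuous _) W nW.
move=> [[A B] /= [nA nB] ABW].
exists (@torus_pi R q @` A, B) => /=; first by split=> //; exact: torus_pi_nbhs.
move=> [_ s] /= [[x Ax <-] Bs]; rewrite torus_flowE.
exact: (ABW (x, s)).
Qed.

End torus_flow.

Theorem theorem7p6 (R : realType) (q n : nat) (q_ge1 : (1 <= q)%N)
  (n_ge1 : (1 <= n)%N) (f : torus R q -> Dn (torus R q) n)
  (f_cont : continuous f) (xs : 'rV[R]_q) (x0 : uconf R q n)
  (fbar : 'rV[R]_q -> uconf R q n)
  (fbar_basic : is_basic_lifting f xs x0 fbar) :
  range (psi fbar) `<=` Jiang f fbar.
Proof.
move=> _ [a _ <-]; have [_ flift _] := fbar_basic.
have [fbar_cont fbarE] := flift.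
exists (f \o torus_flow a), (fbar \o flow a); split.
- split=> [z|y|y].
  + by apply: continuous_comp; [exact: torus_flow_continuous|exact: f_cont].
  + by rewrite /= -(torus_pi_repr y) torus_flowE flow0.
  + by rewrite /= -(torus_pi_repr y) torus_flowE flow1 torus_pi_deck.
- split=> [z|x t].
  + by apply: continuous_comp; [exact: flow_continuous|exact: fbar_cont].
  + by rewrite /= fbarE torus_flowE.
- by move=> x; rewrite /= flow0.
- by move=> x; rewrite /= flow1; have /(congr1 (@^~ x)) := psiP a flift.
Qed.
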